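(* Consider the Cournot duopoly game with uncertainty: for $i=1,2$ and $j=3-i$, player $i$ chooses $x_i\in[0,1/2]$, has type $\theta_i\in\Theta_i=[\alpha_i,\beta_i]$ with $0\le\alpha_i<\beta_i\le1/2$, and has reward $$u_i(x,\theta_i)=x_i(1-x_1-x_2)^+-\theta_ix_i,$$ where $y^+=\max\{y,0\}$. Let $\pi=(\pi_1,\pi_2)\in[0,1]^2$ be the players' attitudes and $\Delta_i=\beta_i-\alpha_i$. Then the unique uncertainty equilibrium with attitudes $\pi$ is the pair of intervals $[s_i-t_i,\,s_i+t_i]$, $i=1,2$, where $$s_i=\tfrac13\Delta_j\pi_i-\tfrac16\Delta_i\pi_j+\tfrac1{12}(4-3\beta_i-5\alpha_i+4\alpha_j),\qquad t_i=\tfrac14(\beta_i-\alpha_i).$$ The strategies that maximize the interim anticipated rewards are $$x_i^*(\pi)=\tfrac13\Delta_j\pi_i-\tfrac16\Delta_i\pi_j+\lambda_i,\qquad \lambda_i=\tfrac16(2-\alpha_i+2\alpha_j-3\theta_i).$$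
   Context: Setting. Player $i$ knows $\theta_i$ but only knows that $\theta_j\in\Theta_j$; this is common knowledge. The strategy space of each player is $X_{i,o}=[0,1/2]$. Attitudes. Player $i$ has attitude $\pi_i\in[0,1]$ ($1$ = optimistic, $0$ = pessimistic). If player $i$ believes $x_j\in X_j$, she maximizes over $x_i\in X_{i,o}$ the quantity $$f_i(x_i,X_j,\theta_i,\pi_i)=\pi_i\max_{x_j\in X_j}u_i(x,\theta_i)+(1-\pi_i)\min_{x_j\in X_j}u_i(x,\theta_i),$$ called her interim anticipated reward when $X_j$ is the equilibrium set. Let $r_i(X_j,\theta_i;\pi_i)$ be the set of maximizers and $\psi_i(X_j;\pi_i)=\bigcup_{\theta_i\in\Theta_i}r_i(X_j,\theta_i;\pi_i)$. Uncertainty equilibrium. A pair of sets $(X_1,X_2)$ is an uncertainty equilibrium for attitudes $\pi$ if $X_i=\psi_i(X_j;\pi_i)$ for $i=1,2$, $j=3-i$. *)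

(* Defs.v *)
From mathcomp Require Import all_boot all_order all_algebra.
From mathcomp Require Import all_classical all_reals.
Set Implicit Arguments.
Unset Strict Implicit.
Unset Printing Implicit Defensive.
Import Order.TTheory GRing.Theory Num.Theory.
Local Open Scope classical_set_scope.
Local Open Scope ring_scope.

(** Player 1 is [true] and player 2 is [false], so that [~~ i] is the
    opponent [j = 3 - i] of player [i]. *)
Definition player := bool.

Section Game.
Variable R : realType.

Definition profile := player -> R.

Definition mk_profile (i : player) (xi xj : R) : profile :=
  fun k => if k == i then xi else xj.

(** [Xo i] is the strategy space, [Theta i] the type set and [u i x theta]
    the reward of player [i]. *)
Variables (Xo Theta : player -> set R) (u : player -> profile -> R -> R).

(** [sup] and [inf] are the maximum and the minimum whenever these are attained,
    in particular when [Xj] is a nonempty compact set and [u] is continuous. *)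
Definition anticipated_reward (i : player) (xi : R) (Xj : set R)
    (theta p : R) : R :=
  p * sup [set u i (mk_profile i xi xj) theta | xj in Xj]
  + (1 - p) * inf [set u i (mk_profile i xi xj) theta | xj in Xj].

Definition best_response (i : player) (Xj : set R) (theta p : R) : set R :=
  [set xi | Xo i xi /\ forall y, Xo i y ->
     anticipated_reward i y Xj theta p <= anticipated_reward i xi Xj theta p].

Definition psi (i : player) (Xj : set R) (p : R) : set R :=
  \bigcup_(theta in Theta i) best_response i Xj theta p.

(** Every [psi i Xj p] is a subset of [Xo i], hence so are the two sets of an
    equilibrium. Beliefs are nonempty sets. *)
Definition uncertainty_equilibrium (att : player -> R)
    (X : player -> set R) : Prop :=
  forall i, X i !=set0 /\ X i = psi i (X (~~ i)) (att i).

End Game.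

Section Cournot.
Variable R : realType.

Definition cournot_strategies (i : player) : set R := `[0, 1 / 2]%classic.

Definition cournot_reward (i : player) (x : profile R) (theta : R) : R :=
  x i * Num.max (1 - x true - x false) 0 - theta * x i.

Variables alpha beta att : player -> R.

Definition cournot_types (i : player) : set R := `[alpha i, beta i]%classic.

Definition cournot_best_response :=
  best_response cournot_strategies cournot_reward.

Definition cournot_equilibrium :=
  uncertainty_equilibrium cournot_strategies cournot_types cournot_reward.

Definition Delta (i : player) : R := beta i - alpha i.

Definition eq_center (i : player) : R :=
  1 / 3 * Delta (~~ i) * att i - 1 / 6 * Delta i * att (~~ i)
  + 1 / 12 * (4 - 3 * beta i - 5 * alpha i + 4 * alpha (~~ i)).

Definition eq_radius (i : player) : R := 1 / 4 * (beta i - alpha i).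

Definition eq_interval (i : player) : set R :=
  `[eq_center i - eq_radius i, eq_center i + eq_radius i]%classic.

Definition lambda (i : player) (theta : R) : R :=
  1 / 6 * (2 - alpha i + 2 * alpha (~~ i) - 3 * theta).

Definition xstar (i : player) (theta : R) : R :=
  1 / 3 * Delta (~~ i) * att i - 1 / 6 * Delta i * att (~~ i)
  + lambda i theta.

End Cournot.

(* Main.v *)
(** Since outputs never exceed [1/2], the price is never truncated, and the
    reward of player [i] is affine and decreasing in [xj]. Hence the interim
    anticipated reward is [xi * (1 - xi - theta - m)], where the single number
    [m = p * inf Xj + (1 - p) * sup Xj] summarizes the belief [Xj]. The unique
    best response is [(1 - theta - m) / 2], so both sets of an equilibrium are
    intervals, and the numbers [m] of the two players solve a nonsingular
    linear system. *)
Require Import Defs.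
From mathcomp Require Import all_boot all_order all_algebra.
From mathcomp Require Import all_classical all_reals.
From mathcomp Require Import ring lra.
Import Order.TTheory GRing.Theory Num.Theory.
Local Open Scope classical_set_scope.
Local Open Scope ring_scope.

Lemma sup_affine (R : realType) (X : set R) (c x : R) :
  0 <= x -> has_inf X -> sup [set c - x * y | y in X] = c - x * inf X.
Proof.
move=> x0 [[z Xz] lbX].
have ubA : ubound [set c - x * y | y in X] (c - x * inf X).
  move=> _ [y Xy <-]; rewrite lerD2l lerN2 ler_wpM2l //; exact: ge_inf.
have A0 : [set c - x * y | y in X] !=set0 by exists (c - x * z), z.
have leA y : X y -> c - x * y <= sup [set c - x * y | y in X].
  by move=> Xy; apply: ub_le_sup; [exists (c - x * inf X) | exists y].
apply/eqP; rewrite eq_le ge_sup //=.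
(* What remains is [c - x * inf X <= sup]. For [x = 0] any point of [X] gives it; for [x > 0] it
   says that [(c - sup) / x] is below [inf X], and this quotient is a lower bound of [X]. *)
move: x0; rewrite [0 <= x]le_eqVlt => /predU1P[x0|x0].
  by have := leA _ Xz; rewrite -x0 !mul0r.
rewrite lerBlDl -lerBlDr -ler_pdivrMl //.
apply: lb_le_inf; first by exists z.
move=> y Xy; rewrite ler_pdivrMl // lerBlDr -lerBlDl; exact: leA.
Qed.

(** Since [inf] is defined as the opposite of the [sup] of the reflected set, this is [sup_affine]
    for [- X] and the constant [- c]. *)
Lemma inf_affine (R : realType) (X : set R) (c x : R) :
  0 <= x -> has_sup X -> inf [set c - x * y | y in X] = c - x * sup X.
Proof.
move=> x0 supX; rewrite /inf image_comp.
have -> : [set (-%R \o (fun y => c - x * y)) y | y in X] =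
    [set - c - x * y | y in -%R @` X].
  by rewrite image_comp; apply: eq_imagel => y _ /=; ring.
rewrite sup_affine //; last by apply/has_inf_supN; rewrite setNK.
by rewrite /inf setNK; ring.
Qed.

(** The number [m]. Optimism puts its weight on the infimum because the opponent's smallest output
    is the most favourable one. *)
Definition weighted_belief {R : realType} (X : set R) (p : R) : R :=
  p * inf X + (1 - p) * sup X.

Lemma convex_itv (R : realDomainType) (p a b l h : R) :
  0 <= p <= 1 -> l <= a <= h -> l <= b <= h -> l <= p * a + (1 - p) * b <= h.
Proof. by nra. Qed.

Section CournotResponse.
Variables (R : realType) (i : player) (X : set R) (p : R).
Hypotheses (X0 : X !=set0) (Xsub : X `<=` `[0, 1 / 2]) (hp : 0 <= p <= 1).

Lemma strategies_has_inf : has_inf X.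
Proof.
by split=> //; exists 0 => y /Xsub; rewrite /= in_itv /= => /andP[].
Qed.

Lemma strategies_has_sup : has_sup X.
Proof.
by split=> //; exists (1 / 2) => y /Xsub; rewrite /= in_itv /= => /andP[].
Qed.

Lemma weighted_belief_itv : 0 <= weighted_belief X p <= 1 / 2.
Proof.
have [[z Xz] infX] := strategies_has_inf; have [_ supX] := strategies_has_sup.
have bnd y : X y -> 0 <= y <= 1 / 2 by move=> /Xsub; rewrite /= in_itv.
have h1 : 0 <= inf X by apply: lb_le_inf => // y /bnd/andP[].
have h2 : sup X <= 1 / 2 by apply: ge_sup => // y /bnd/andP[].
have h3 : inf X <= z by apply: ge_inf.
have h4 : z <= sup X by apply: ub_le_sup.
apply: convex_itv => //; lra.
Qed.

Lemma cournot_anticipatedE (x theta : R) : 0 <= x <= 1 / 2 ->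
  anticipated_reward (@cournot_reward R) i x X theta p =
  x * (1 - x - theta - weighted_belief X p).
Proof.
move=> /andP[x0 x2]; rewrite /anticipated_reward.
have -> : [set cournot_reward i (mk_profile i x y) theta | y in X] =
    [set x * (1 - x - theta) - x * y | y in X].
  apply: eq_imagel => y /Xsub; rewrite /= in_itv /= => /andP[y0 y2].
  have y1 : x + y <= 1 by lra.
  by rewrite /cournot_reward /mk_profile; case: (i) => /=;
    rewrite max_l; lra.
rewrite sup_affine ?inf_affine //; [|exact: strategies_has_sup|exact: strategies_has_inf].
by rewrite /weighted_belief; ring.
Qed.

Lemma cournot_best_responseE (theta : R) : 0 <= theta <= 1 / 2 ->
  cournot_best_response i X theta p =
  [set (1 - theta - weighted_belief X p) / 2].
Proof.
move=> htheta; have hm := weighted_belief_itv.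
set m := weighted_belief X p in hm *; set b := (1 - theta - m) / 2.
(* Feasible because [theta] and [m] both lie in [[0, 1/2]], so [1 - theta - m] lies in [[0, 1]]. *)
have hb : 0 <= b <= 1 / 2 by rewrite /b; lra.
(* Completing the square: the loss from playing [y] instead of [b] is exactly [(y - b) ^+ 2], which
   yields optimality and uniqueness at once. *)
have gap y : b * (1 - b - theta - m) - y * (1 - y - theta - m) = (y - b) ^+ 2.
  by rewrite /b; field.
apply/seteqP; split=> [x [] | _ ->].
  rewrite /cournot_strategies /= in_itv /= => hx /(_ b).
  rewrite /cournot_strategies /= in_itv /= => /(_ hb).
  rewrite !cournot_anticipatedE // -/m -subr_le0 gap => sq_le0.
  by apply/eqP; rewrite -subr_eq0 -sqrf_eq0 eq_le sq_le0 sqr_ge0.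
split; rewrite /cournot_strategies /= ?in_itv //= => y; rewrite in_itv /= => hy.
by rewrite !cournot_anticipatedE // -/m -subr_ge0 gap sqr_ge0.
Qed.

Lemma cournot_psiE (alpha beta : player -> R) :
  0 <= alpha i -> beta i <= 1 / 2 ->
  psi (@cournot_strategies R) (cournot_types alpha beta) (@cournot_reward R)
    i X p =
  `[(1 - beta i - weighted_belief X p) / 2,
    (1 - alpha i - weighted_belief X p) / 2]%classic.
Proof.
move=> ha hb; apply/seteqP; split=> x.
  move=> [t]; rewrite /cournot_types /= in_itv /= => ht.
  rewrite -/(cournot_best_response _ _ _ _) cournot_best_responseE; last lra.
  by move=> ->; rewrite /= in_itv /=; lra.
(* The witness is the type whose best response is [x], found by inverting
   [x = (1 - theta - m) / 2]. *)
rewrite /= in_itv /= => hx; exists (1 - weighted_belief X p - 2 * x).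
  by rewrite /cournot_types /= in_itv /=; lra.
rewrite -/(cournot_best_response _ _ _ _) cournot_best_responseE /=; last lra.
by field.
Qed.

End CournotResponse.

Section CournotEquilibrium.
Variables (R : realType) (alpha beta att : player -> R).
Hypotheses (halpha : forall i, 0 <= alpha i)
  (hab : forall i, alpha i < beta i) (hbeta : forall i, beta i <= 1 / 2)
  (hatt : forall i, 0 <= att i <= 1).

(* The weighted type of the opponent as seen by player [i]; the equations
   [2 * m i + m j = 1 - c i] for the weighted beliefs give
   [3 * m i = 1 - 2 * c i + c j]. *)
Let c i := alpha (~~ i) + att i * Delta alpha beta (~~ i).

Let c_itv i : alpha (~~ i) <= c i <= beta (~~ i).
Proof.
have := hatt i; have := hab (~~ i); rewrite /c /Delta.
move: (alpha _) (beta _) (att _) => a b p; nra.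
Qed.

(** In terms of [c], this endpoint is the best response of the highest type [beta i] to the weighted
    belief [(1 - 2 * c i + c (~~ i)) / 3]; the other endpoint is that of [alpha i]. *)
Lemma eq_interval_lo i :
  eq_center alpha beta att i - eq_radius alpha beta i =
  (2 - 3 * beta i + 2 * c i - c (~~ i)) / 6.
Proof. by rewrite /eq_center /eq_radius /c /Delta negbK; field. Qed.

Lemma eq_interval_hi i :
  eq_center alpha beta att i + eq_radius alpha beta i =
  (2 - 3 * alpha i + 2 * c i - c (~~ i)) / 6.
Proof. by rewrite /eq_center /eq_radius /c /Delta negbK; field. Qed.

Lemma eq_interval_neq0 i : eq_interval alpha beta att i !=set0.
Proof.
exists (eq_center alpha beta att i - eq_radius alpha beta i).
have := hab i; rewrite /eq_interval /= in_itv /= eq_interval_lo eq_interval_hi.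
by lra.
Qed.

(** All types and both numbers [c] lie in [[0, 1/2]], so the numerator over 6 is at least
    [2 - 3/2 - 1/2 = 0] at the lower end and at most [2 + 1 = 3] at the upper end. *)
Lemma eq_interval_strategies i :
  eq_interval alpha beta att i `<=` `[0, 1 / 2].
Proof.
move=> x; rewrite /eq_interval /= !in_itv /= eq_interval_lo eq_interval_hi.
have := c_itv i; have := c_itv (~~ i); rewrite negbK.
have := halpha i; have := hbeta i; have := halpha (~~ i); have := hbeta (~~ i).
by lra.
Qed.

Lemma weighted_belief_itvcc (a b p : R) : a <= b ->
  weighted_belief `[a, b]%classic p = p * a + (1 - p) * b.
Proof. by move=> ab; rewrite /weighted_belief inf_itvcc // sup_itvcc. Qed.

Lemma eq_interval_belief i :
  weighted_belief (eq_interval alpha beta att (~~ i)) (att i) =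
  (1 - 2 * c i + c (~~ i)) / 3.
Proof.
rewrite /eq_interval eq_interval_lo eq_interval_hi weighted_belief_itvcc.
  by rewrite /c /Delta negbK; field.
by have := hab (~~ i); lra.
Qed.

Lemma equilibrium_best_response i (theta : R) :
  cournot_types alpha beta i theta ->
  cournot_best_response i (eq_interval alpha beta att (~~ i)) theta (att i)
  = [set xstar alpha beta att i theta].
Proof.
rewrite /cournot_types /= in_itv /= => ht.
have h1 := halpha i; have h2 := hbeta i.
rewrite cournot_best_responseE //; last lra;
  [|exact: eq_interval_neq0|exact: eq_interval_strategies].
rewrite eq_interval_belief; congr [set _].
by rewrite /xstar /lambda /c /Delta negbK; field.
Qed.

Lemma eq_interval_equilibrium :
  cournot_equilibrium alpha beta att (eq_interval alpha beta att).
Proof.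
move=> i; split; first exact: eq_interval_neq0.
rewrite cournot_psiE //; [|exact: eq_interval_neq0|exact: eq_interval_strategies].
rewrite eq_interval_belief /eq_interval eq_interval_lo eq_interval_hi.
by apply: (f_equal2 (fun a b : R => `[a, b]%classic)); field.
Qed.

Lemma equilibrium_unique (X : player -> set R) :
  cournot_equilibrium alpha beta att X ->
  forall i, X i = eq_interval alpha beta att i.
Proof.
move=> eqX.
have Xsub i : X i `<=` `[0, 1 / 2] by have [_ ->] := eqX i; move=> x [t _ []].
have XE i : X i =
    `[(1 - beta i - weighted_belief (X (~~ i)) (att i)) / 2,
      (1 - alpha i - weighted_belief (X (~~ i)) (att i)) / 2]%classic.
  have [_ {1}->] := eqX i.
  by rewrite cournot_psiE //; have [] := eqX (~~ i).
(* The opponent's set is an interval whose endpoints depend only on the opponent's own weighted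
   belief, so each of the two numbers is an affine function of the other. *)
have mE i : weighted_belief (X (~~ i)) (att i) =
    (1 - c i - weighted_belief (X i) (att (~~ i))) / 2.
  rewrite {1}XE negbK weighted_belief_itvcc; last by have := hab (~~ i); lra.
  by rewrite /c /Delta; field.
(* The relations for both players form a linear system with determinant 3, which fixes the weighted
   beliefs and hence the endpoints. *)
move=> i; have := mE (~~ i); rewrite negbK => mj; have mi := mE i.
rewrite XE /eq_interval eq_interval_lo eq_interval_hi.
by apply: (f_equal2 (fun a b : R => `[a, b]%classic)); lra.
Qed.

End CournotEquilibrium.

Theorem theorem2 (R : realType) (alpha beta att : player -> R)
    (halpha : forall i, 0 <= alpha i)
    (hab : forall i, alpha i < beta i)
    (hbeta : forall i, beta i <= 1 / 2)
    (hatt : forall i, 0 <= att i <= 1) :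
  [/\ cournot_equilibrium alpha beta att (eq_interval alpha beta att),
      (forall X : player -> set R, cournot_equilibrium alpha beta att X ->
         forall i, X i = eq_interval alpha beta att i)
    & forall (i : player) (theta : R), cournot_types alpha beta i theta ->
        cournot_best_response i (eq_interval alpha beta att (~~ i)) theta (att i)
        = [set xstar alpha beta att i theta] ].
Proof.
split; [exact: eq_interval_equilibrium | exact: equilibrium_unique |].
exact: equilibrium_best_response.
Qed.
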